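(* Let $\beta>0$, $\varepsilon\in(0,1]$ and $p_{\mathrm{ref}}\in(0,1]$. Let $p^*\in[0,1]$ be a fixed point of $h_{\varepsilon,p_{\mathrm{ref}}}$ and assume that $|h'_{\varepsilon,p_{\mathrm{ref}}}(p^* )|<1$. Then there exists $\delta>0$ such that, if $p_0=p_{\mathrm{ref}}\in[p^*-\delta,p^*+\delta]$, the iteration $p_n=h_{\varepsilon,p_{\mathrm{ref}}}(p_{n-1})$, $n\ge1$, converges to $p^*$: $$\lim_{n\to\infty}p_n=p^*.$$
   Context: For $p_{\mathrm{ref}}\in(0,1]$ the map $h_{\varepsilon,p_{\mathrm{ref}}}:[0,1]\to[0,1]$ is $$h_{\varepsilon,p_{\mathrm{ref}}}(p)=\frac{1}{1+\frac{1-p_{\mathrm{ref}}}{p_{\mathrm{ref}}}\exp\!\left(-\frac1\beta\frac{1}{\sqrt{p(1-p)+\varepsilon}}\right)};$$ $h'_{\varepsilon,p_{\mathrm{ref}}}$ denotes its derivative in $p$ (one-sided at the endpoints). Both are continuous on $[0,1]$. *)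

(* Defs.v *)
From mathcomp Require Import all_boot all_order all_algebra.
From mathcomp Require Import all_classical all_reals all_analysis.
Set Implicit Arguments.
Unset Strict Implicit.
Unset Printing Implicit Defensive.
Import Order.TTheory GRing.Theory Num.Theory.
Import numFieldNormedType.Exports.
Local Open Scope classical_set_scope.
Local Open Scope ring_scope.

(* The formula is total on R; it is meant for p in [0, 1], an interval which
   it maps into itself as soon as 0 < pref <= 1. *)
Definition h (R : realType) (beta eps pref : R) (p : R) : R :=
  1 / (1 + (1 - pref) / pref *
             expR (- (1 / beta * (1 / Num.sqrt (p * (1 - p) + eps))))).

(* Derivative at p of f seen as a function on [0, 1]: the difference quotient
   is only taken at points x of [0, 1] with x != p, hence it is the one-sided
   derivative at p = 0 and p = 1 and the usual one when 0 < p < 1. *)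
Definition deriv01 (R : realType) (f : R -> R) (p : R) : R :=
  lim ((f x - f p) / (x - p) @[x --> within `[0, 1] p^']).

(* Main.v *)
(* Near the fixed point the difference quotient of h on [0, 1] is bounded in
   absolute value by some c < 1, so h contracts distances to pstar by the factor
   c there; as h preserves [0, 1], the iterates satisfy
   |p n - pstar| <= c ^ n |p 0 - pstar|. *)
Require Import Defs.
From mathcomp Require Import all_boot all_order all_algebra.
From mathcomp Require Import all_classical all_reals all_analysis.
Import Order.TTheory GRing.Theory Num.Theory.
Import numFieldNormedType.Exports.
Local Open Scope classical_set_scope.
Local Open Scope ring_scope.

(** ['D_1 f p] is a limit over increments tending to 0; the substitution of [x - p] for the
    increment gives the quotient used in [deriv01]. *)
Lemma diff_quotient_cvg (R : realType) (f : R -> R) (p : R) :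
  derivable f p 1 ->
  (f x - f p) / (x - p) @[x --> p^'] --> 'D_1 f p.
Proof.
move=> df A /df /nbhs_ballP[e /= e0 eA].
apply/nbhs_ballP; exists e => //= x; rewrite /ball /= => xe xp.
have := eA (x - p).
rewrite /ball /= sub0r normrN distrC => /(_ xe); rewrite subr_eq0 => /(_ xp).
by rewrite /= [_ *: 1]mulr1 subrK [_ *: _]mulrC.
Qed.

Lemma derivable_comp1 (R : realType) (f g : R -> R) (x : R) :
  derivable g x 1 -> derivable f (g x) 1 -> derivable (fun y => f (g y)) x 1.
Proof.
move=> /derivable1_diffP dg /derivable1_diffP df.
exact/derivable1_diffP/(differentiable_comp dg df).
Qed.

(** Properness makes limits along this filter unique, so that the [lim] in [deriv01] can be computed
    from a convergence proof. *)
Lemma within_itv01_dnbhs_proper (R : realType) (p : R) :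
  0 <= p <= 1 -> ProperFilter (within `[0, 1] p^').
Proof.
move=> /andP[p0 p1]; apply: Build_ProperFilter_ex => A /nbhs_ballP[e /= e0 eA].
(* The step length is below [e] to stay in the ball, and at most 1/2 so that a step from [p] towards
   the farther endpoint stays in [0, 1]. *)
have d0 : 0 < Num.min (e / 2) (2^-1 : R).
  by rewrite lt_min divr_gt0//= invr_gt0.
have de : Num.min (e / 2) (2^-1 : R) < e.
  by rewrite gt_min ltr_pdivrMr// ltr_pMr// ltr1n.
have d1 : Num.min (e / 2) (2^-1 : R) <= 2^-1 by rewrite ge_min lexx orbT.
move: (Num.min _ _) d0 de d1 => d d0 de d1.
have [ph|hp] := lerP p (2^-1 : R).
- exists (p + d); apply: eA => /=.
  + by rewrite /ball /= opprD addNKr normrN gtr0_norm.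
  + by rewrite -subr_eq0 addrAC subrr add0r gt_eqF.
  + rewrite in_itv/= addr_ge0 ?(ltW d0)//=.
    by rewrite [leRHS](splitr 1) mul1r lerD.
- exists (p - d); apply: eA => /=.
  + by rewrite /ball /= opprB addrC subrK gtr0_norm.
  + by rewrite -subr_eq0 addrAC subrr add0r oppr_eq0 gt_eqF.
  + rewrite in_itv/= subr_ge0 (le_trans d1 (ltW hp))/=.
    by rewrite (le_trans _ p1)// gerBl ltW.
Qed.

(** A limit over the full punctured neighbourhood survives restriction to [0, 1]; at 0 and 1 the
    one-sided derivative thus agrees with the two-sided one. *)
Lemma deriv01E (R : realType) (f : R -> R) (p : R) :
  0 <= p <= 1 -> derivable f p 1 -> deriv01 f p = 'D_1 f p.
Proof.
move=> p01 df; have pf := within_itv01_dnbhs_proper _ _ p01.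
apply: cvg_lim => //; apply: cvg_within_filter.
exact: diff_quotient_cvg.
Qed.

Lemma derivable_contracting (R : realType) (f : R -> R) (p : R) :
  derivable f p 1 -> `|'D_1 f p| < 1 ->
  exists c delta : R, [/\ 0 <= c < 1, 0 < delta &
    forall x, `|x - p| <= delta -> `|f x - f p| <= c * `|x - p|].
Proof.
(* The midpoint between the absolute value of the derivative and 1 leaves room on both sides. *)
move=> df lt1; pose c := (`|'D_1 f p| + 1) / 2.
have [Dc c1] := midf_lt lt1.
have /(cvgr_norm_lt _) /(_ _ Dc) := diff_quotient_cvg _ _ _ df.
move=> /nbhs_ballP[e /= e0 eP].
(* Halving [e] fits the closed neighbourhood of the conclusion inside the open ball. *)
exists c, (e / 2); split; rewrite ?divr_gt0// ?c1 ?andbT.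
  by rewrite (le_trans _ (ltW Dc)).
move=> x xe; have [->|xp] := eqVneq x p; first by rewrite !subrr !normr0 mulr0.
rewrite -ler_pdivrMr ?normr_gt0 ?subr_eq0// -normf_div ltW// eP//.
by rewrite /ball /= distrC (le_lt_trans xe)// ltr_pdivrMr// ltr_pMr// ltr1n.
Qed.

(** The estimate is local, but a factor below 1 never increases the distance to [p], so the orbit
    stays where it applies; a geometric squeeze concludes. *)
Lemma contracting_iterates_cvg (R : realType) (A : set R) (f : R -> R)
    (p c delta : R) (u : nat -> R) :
  0 <= c < 1 ->
  (forall x, A x -> A (f x)) ->
  (forall x, A x -> `|x - p| <= delta -> `|f x - p| <= c * `|x - p|) ->
  A (u 0%N) -> `|u 0%N - p| <= delta -> (forall n, u n.+1 = f (u n)) ->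
  u n @[n --> \oo] --> p.
Proof.
move=> /andP[c0 c1] fA fc u0A u0d uS.
have bound n : [/\ A (u n), `|u n - p| <= delta &
    `|u n - p| <= geometric `|u 0%N - p| c n].
  elim: n => [|n [un und unc]]; first by rewrite /= expr0 mulr1.
  have fun_le := fc _ un und; rewrite uS; split; first exact: fA.
    by apply: le_trans fun_le (le_trans _ und); rewrite ler_piMl// ltW.
  by apply: le_trans fun_le _; rewrite /= exprS mulrCA ler_wpM2l.
apply/subr_cvg0/norm_cvg0P/(@squeeze_cvgr _ _ _ _ (cst 0) (geometric `|u 0%N - p| c)).
- by near=> n; rewrite /= normr_ge0; have [] := bound n.
- exact: cvg_cst.
- by apply: cvg_geometric; rewrite ger0_norm.
Unshelve. all: by end_near. Qed.

Lemma h_denom_ge1 (R : realType) (pref t : R) :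
  0 < pref -> pref <= 1 -> 1 <= 1 + (1 - pref) / pref * expR t.
Proof.
move=> pref_gt0 pref_le1.
by rewrite lerDl mulr_ge0 ?expR_ge0// divr_ge0 ?subr_ge0// ltW.
Qed.

Lemma h_itv01 (R : realType) (beta eps pref x : R) :
  0 < pref -> pref <= 1 -> 0 <= h beta eps pref x <= 1.
Proof.
move=> pref_gt0 pref_le1; rewrite /h; set d := 1 + _.
have d1 : 1 <= d by exact: h_denom_ge1.
have d0 : 0 < d := lt_le_trans ltr01 d1.
by rewrite divr_ge0 ?(ltW d0)//= ler_pdivrMr// mul1r.
Qed.

(** Positivity of the radicand makes the square root differentiable and nonzero at [x]. It includes
    the endpoints 0 and 1 when [eps] is positive, since the formula extends past them. *)
Lemma derivable_h (R : realType) (beta eps pref x : R) :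
  0 < pref -> pref <= 1 ->
  0 < x * (1 - x) + eps -> derivable (h beta eps pref) x 1.
Proof.
move=> pref_gt0 pref_le1 r0; pose r (y : R) := y * (1 - y) + eps.
pose s (y : R) := Num.sqrt (r y).
have dr : derivable r x 1 by [].
have ds : derivable s x 1.
  by apply: (derivable_comp1 _ Num.sqrt r _ dr); have [] := is_derive1_sqrt r0.
have s0 : s x != 0 by rewrite gt_eqF ?sqrtr_gt0.
pose t (y : R) := - (1 / beta * (1 / s y)).
have dt : derivable t x 1.
  apply: derivableN; apply: derivableM; first exact: derivable_cst.
  by apply: derivableM; [exact: derivable_cst|exact: derivableV].
have de : derivable (fun y => expR (t y)) x 1.
  by apply: (derivable_comp1 _ expR t _ dt); exact: derivable_expR.
pose d (y : R) := 1 + (1 - pref) / pref * expR (t y).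
have dd : derivable d x 1.
  apply: derivableD; first exact: derivable_cst.
  by apply: derivableM; first exact: derivable_cst.
apply: (@derivableM _ _ (cst 1) (fun y => (d y)^-1)).
  exact: derivable_cst.
by apply: derivableV => //; rewrite gt_eqF// (lt_le_trans ltr01)// h_denom_ge1.
Qed.

Theorem theorem6 (R : realType) (beta eps pref pstar : R)
  (beta_gt0 : 0 < beta)
  (eps_gt0 : 0 < eps) (eps_le1 : eps <= 1)
  (pref_gt0 : 0 < pref) (pref_le1 : pref <= 1)
  (pstar_ge0 : 0 <= pstar) (pstar_le1 : pstar <= 1)
  (pstar_fixed : h beta eps pref pstar = pstar)
  (contracting : `|deriv01 (h beta eps pref) pstar| < 1) :
  exists delta : R, 0 < delta /\
    (forall p : nat -> R,
       p 0%N = pref -> pstar - delta <= pref <= pstar + delta ->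
       (forall n : nat, (1 <= n)%N -> p n = h beta eps pref (p n.-1)) ->
       p n @[n --> \oo] --> pstar) /\
    (forall p : nat -> R,
       0 <= p 0%N <= 1 -> pstar - delta <= p 0%N <= pstar + delta ->
       (forall n : nat, (1 <= n)%N -> p n = h beta eps pref (p n.-1)) ->
       p n @[n --> \oo] --> pstar).
Proof.
have ps01 : 0 <= pstar <= 1 by rewrite pstar_ge0.
have dh : derivable (h beta eps pref) pstar 1.
  by apply: derivable_h => //; rewrite ltr_wpDl// mulr_ge0// subr_ge0.
move: contracting; rewrite deriv01E// => lt1.
have [c [delta [c01 d0 hc]]] := derivable_contracting _ _ _ dh lt1.
rewrite pstar_fixed in hc.
(* The starting point is kept independent of the parameter [pref] of the map; the start at [pref] is
   then a special case with the same [delta]. *)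
have main (p : nat -> R) : 0 <= p 0%N <= 1 ->
    pstar - delta <= p 0%N <= pstar + delta ->
    (forall n : nat, (1 <= n)%N -> p n = h beta eps pref (p n.-1)) ->
    p n @[n --> \oo] --> pstar.
  move=> p01 pd pS.
  apply: (contracting_iterates_cvg _ [set x | 0 <= x <= 1]
    (h beta eps pref) _ c delta) => //.
  - by move=> x _; exact: h_itv01.
  - by move=> x _; exact: hc.
  - by rewrite ler_distl.
  - by move=> n; rewrite pS.
exists delta; split=> //; split=> // p p0 pd.
by apply: main; rewrite p0// (ltW pref_gt0).
Qed.
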